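(* Let $N\ge 2$ be even, and let $g:\mathcal W\to\mathbb R$, $g(\mathbf W):=\frac12\|\mathbf W_1\mathbf W_2\cdots \mathbf W_N\mathbf X-\mathbf Y\|_F^2$. Define $$H_1(\mathbf W):=\left(\frac{\|\mathbf W\|_F^2}{N}\right)^N,\qquad H_2(\mathbf W):=\left(\frac{\|\mathbf W\|_F^2}{N}\right)^{\frac N2}.$$ Then, for $L=1$, the function $g$ satisfies the $L$-smad property (on $\mathcal W$) with respect to the kernel generating distance $$H_a(\mathbf W)=c_1(N)H_1(\mathbf W)+c_2(N)H_2(\mathbf W),$$ where $$c_1(N)=\frac{(2N-1)N^N}{2\,N!}\|\mathbf X\|_F^2,\qquad c_2(N)=\frac{\|\mathbf Y\|_F\|\mathbf X\|_F(N-1)N^{\frac{N-2}{2}}}{(N-2)^{\frac{N-2}{2}}}.$$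
   Context: Setting: $N\ge2$ is an integer, $d_1,\dots,d_N,d,n_T$ are positive integers, $d_{N+1}:=d$, $\mathcal W_i:=\mathbb R^{d_i\times d_{i+1}}$, and $\mathcal W:=\mathcal W_1\times\cdots\times\mathcal W_N$ (viewed as a Euclidean space), with elements $\mathbf W=(\mathbf W_1,\dots,\mathbf W_N)$ and norm $\|\mathbf W\|_F^2:=\sum_{i=1}^N\|\mathbf W_i\|_F^2$. The matrices $\mathbf X\in\mathbb R^{d\times n_T}$ and $\mathbf Y\in\mathbb R^{d_1\times n_T}$ are fixed. When $N=2$, $(N-2)^{(N-2)/2}$ is read as $0^0=1$. Kernel generating distance: a function $h:\mathbb R^m\to(-\infty,+\infty]$ is a kernel generating distance associated with a nonempty convex open set $C$ if (i) $h$ is proper, lower semicontinuous and convex, with $\mathrm{dom}\,h\subset\overline C$ and $\mathrm{dom}\,\partial h=C$; (ii) $h$ is $C^1$ on $\mathrm{int}\,\mathrm{dom}\,h=C$. Here $C$ is the whole space. $L$-smad property: a continuously differentiable function $g$ satisfies the $L$-smad property with respect to $h$ (equivalently, $(g,h)$ is $L$-smooth adaptable), for $L>0$, if both $Lh-g$ and $Lh+g$ are convex on the whole space. *)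

(* Defs.v *)
From HB Require Import structures.
From mathcomp Require Import all_boot all_order all_algebra.
From mathcomp Require Import all_classical all_reals all_analysis.

Set Implicit Arguments.
Unset Strict Implicit.
Unset Printing Implicit Defensive.

Import Order.TTheory GRing.Theory Num.Theory.
Import numFieldNormedType.Exports.

Local Open Scope classical_set_scope.
Local Open Scope ring_scope.

(* R^m is 'rV[R]_m. The library norm on it is the sup norm, which induces the
   Euclidean topology; the inner product and Frobenius norms are explicit. *)

Section KernelGeneratingDistance.
Context {R : realType} {m : nat}.
Local Notation E := 'rV[R]_m.

Definition dotprod (u v : E) : R := \sum_j u ord0 j * v ord0 j.

Definition gradient (f : E -> R) (x : E) : E :=
  \row_j 'D_(delta_mx ord0 j) f x.

(* Meant for [C] open. *)
Definition C1_on (C : set E) (f : E -> R) : Prop :=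
  (forall x, C x -> differentiable f x) /\
  (forall x, C x -> {for x, continuous (gradient f)}).

Definition edom (h : E -> \bar R) : set E := [set x | (h x < +oo)%E].

Definition proper (h : E -> \bar R) : Prop :=
  (forall x, (-oo < h x)%E) /\ edom h !=set0.

(* To be used for [h] without the value -oo; recall 0 * +oo = 0 in \bar R. *)
Definition econvex (h : E -> \bar R) : Prop :=
  forall (x y : E) (t : R), 0 <= t <= 1 ->
    (h (t *: x + (1 - t) *: y)%R <= t%:E * h x + (1 - t)%:E * h y)%E.

Definition subdifferential (h : E -> \bar R) (x : E) : set E :=
  [set v | edom h x /\
    forall y, (h x + (dotprod v (y - x))%:E <= h y)%E].

Definition dom_subdifferential (h : E -> \bar R) : set E :=
  [set x | subdifferential h x !=set0].

Definition kernel_generating_distance (C : set E) (h : E -> \bar R) : Prop :=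
  [/\ C !=set0, @convex_set R E C & open C] /\
  [/\ proper h, lower_semicontinuous h & econvex h] /\
  [/\ edom h `<=` closure C,
      dom_subdifferential h = C,
      (edom h)° = C
    & C1_on C (fine \o h)].

(* [h] is real-valued: the kernel's open set is the whole space here. *)
Definition smad (L : R) (g h : E -> R) : Prop :=
  [/\ 0 < L,
      C1_on setT g,
      @convex_function R E setT (fun x => L * h x - g x)
    & @convex_function R E setT (fun x => L * h x + g x)].

End KernelGeneratingDistance.

Definition frob {R : realType} {m n : nat} (A : 'M[R]_(m, n)) : R :=
  Num.sqrt (\sum_i \sum_j A i j ^+ 2).

Section DeepLinearNetwork.
Context {R : realType}.

(* The sequence [d] is 0-based: [d 0, ..., d N] are d_1, ..., d_(N+1). *)
Fixpoint chainmx (d : nat -> nat) (n : nat) :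
    (forall i : 'I_n, 'M[R]_(d i, d i.+1)) -> 'M[R]_(d 0, d n) :=
  match n with
  | 0 => fun=> 1%:M
  | n'.+1 => fun W =>
      chainmx (fun i : 'I_n' => W (widen_ord (leqnSn n') i)) *m W ord_max
  end.

Context (d : nat -> nat) (N : nat).

(* The product of the matrix spaces, as a Euclidean space: the coordinates of
   W_1, ..., W_N (each flattened) are concatenated into one row vector. *)
Definition wspace := 'rV[R]_(\sum_(i < N) d i * d i.+1).

Definition layer (W : wspace) (i : 'I_N) : 'M[R]_(d i, d i.+1) :=
  vec_mx (@submxrow R N (fun i : 'I_N => (d i * d i.+1)%N) 1 W i).

Definition wnorm (W : wspace) : R :=
  Num.sqrt (\sum_(i < N) frob (layer W i) ^+ 2).

Definition objective (nT : nat) (X : 'M[R]_(d N, nT)) (Y : 'M[R]_(d 0, nT))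
    (W : wspace) : R :=
  2^-1 * frob (chainmx (layer W) *m X - Y) ^+ 2.

Definition H1 (W : wspace) : R := (wnorm W ^+ 2 / N%:R) ^+ N.

(* N./2 and (N - 2)./2 below are exact halves, as N is even and N >= 2. *)
Definition H2 (W : wspace) : R := (wnorm W ^+ 2 / N%:R) ^+ N./2.

Definition c1 (nT : nat) (X : 'M[R]_(d N, nT)) : R :=
  ((2 * N%:R - 1) * N%:R ^+ N) / (2 * (N`!)%:R) * frob X ^+ 2.

(* For N = 2 the denominator is 0 ^+ 0 = 1. *)
Definition c2 (nT : nat) (X : 'M[R]_(d N, nT)) (Y : 'M[R]_(d 0, nT)) : R :=
  (frob Y * frob X * (N%:R - 1) * N%:R ^+ (N - 2)./2)
  / (N%:R - 2) ^+ (N - 2)./2.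

Definition Ha (nT : nat) (X : 'M[R]_(d N, nT)) (Y : 'M[R]_(d 0, nT))
    (W : wspace) : R :=
  c1 X * H1 W + c2 X Y * H2 W.

End DeepLinearNetwork.

(* Main.v *)
Require Import Defs.
From HB Require Import structures.
From mathcomp Require Import all_boot all_order all_algebra.
From mathcomp Require Import all_classical all_reals all_analysis.
From mathcomp Require Import ring lra.

Import Order.TTheory GRing.Theory Num.Theory.
Import numFieldNormedType.Exports.

Local Open Scope classical_set_scope.
Local Open Scope ring_scope.

(** Let [w i] and [v i] be the Frobenius norms of the layers of [W] and of a
    direction [V], [s] the sum of the [w i ^+ 2] and [S] that of the
    [v i ^+ 2].  Everything follows from one pointwise bound between second
    directional derivatives: that of the objective at [W] along [V] is, in
    absolute value, at most that of [Ha].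

    With [F = W_1 ... W_N X - Y], the second derivative of the objective is
    [<F', F'> + <F, F''>].  By the product rule and submultiplicativity of the
    Frobenius norm, the norms of [F'] and [F''] are at most those of the scalar
    chain with factors [w i], times the norm [x] of [X]: [sum1 w v] replaces
    one factor [w i] by [v i], and [sum2 w v] replaces two
    ([frob_chainmx_le], [frob_dchain_le], [frob_ddchain_le]).  This leaves a
    part [x ^+ 2 * (sum1 ^+ 2 + (\prod_i w i) * sum2)] free of [Y] and a part
    [|Y| * x * sum2].

    - In the first part, [\prod_i w i * sum2] is [sum1 ^+ 2] minus its diagonal
      terms ([prodM_sum2]), so the bracket is at most
      [(2 - 1 / N) * sum1 ^+ 2]; Cauchy-Schwarz and the arithmetic-geometric
      mean inequality for the products of [N - 1] factors, together with
      [(N - 1)! <= (N - 1) ^ (N - 1)], give the constant [c1]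
      ([sum1_sum2_le]).
    - In the second part, the same mean inequality for products of [N - 2]
      factors, and the bound [(N - 1) * S] for the sum of the [v i * v j] with
      [i != j], give [c2] ([sum2_le]).

    On the other side the second derivative of [(s / N) ^+ n] is
    [n * (s / N) ^+ (n - 1) * (2 * S / N)] plus a multiple of the square of
    [<W, V>], which is dropped ([ddnormpow_ge]); for [n = N] and [n = N / 2]
    what remains is exactly what the constants [c1] and [c2] require
    ([c1_bound], [c2_bound]).

    Hence [Ha + a * objective] has a nonnegative second derivative whenever
    [`|a| <= 1].  Such a function lies above its tangents ([ge_tangent], two
    uses of the mean value theorem), which yields convexity for
    [a = 1] and [a = -1], and for [a = 0] both the convexity of [Ha] and, the
    gradient being a subgradient, the whole of its domain of
    subdifferentiability ([kernel_of_tangent]).  Continuous differentiability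
    is automatic because all the functions are polynomials in the coordinates
    ([polyfun_C1]). *)

Set Implicit Arguments.
Unset Strict Implicit.
Unset Printing Implicit Defensive.

(** * Cauchy-Schwarz and the Frobenius norm *)

(** Lagrange's identity: the defect is half the sum of the squares of the
    [a i * b j - a j * b i]. *)
Lemma cauchy_schwarz (R : realDomainType) (I : finType) (a b : I -> R) :
  (\sum_i a i * b i) ^+ 2 <= (\sum_i a i ^+ 2) * (\sum_i b i ^+ 2).
Proof.
have lagrange : \sum_i \sum_j (a i * b j - a j * b i) ^+ 2 =
    ((\sum_i a i ^+ 2) * (\sum_i b i ^+ 2) - (\sum_i a i * b i) ^+ 2) *+ 2.
  have sqE i j : (a i * b j - a j * b i) ^+ 2 =
      a i ^+ 2 * b j ^+ 2 + a j ^+ 2 * b i ^+ 2 -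
      ((a i * b i) * (a j * b j)) *+ 2 by ring.
  under eq_bigr do under eq_bigr do rewrite sqE.
  under eq_bigr do rewrite sumrB big_split/= sumrMnl.
  rewrite sumrB big_split/= sumrMnl.
  rewrite [X in _ + X - _]exchange_big/= -!big_distrlr/=; ring.
rewrite -subr_ge0 -(@pmulrn_lge0 _ _ 2)// -lagrange.
by apply: sumr_ge0 => i _; apply: sumr_ge0 => j _; apply: sqr_ge0.
Qed.

Section Frobenius.
Context {R : realType}.
Implicit Types m n p : nat.

Definition mxdot m n (A B : 'M[R]_(m, n)) : R := \sum_i \sum_j A i j * B i j.

Lemma frob_ge0 m n (A : 'M[R]_(m, n)) : 0 <= frob A.
Proof. exact: sqrtr_ge0. Qed.

Lemma sqr_frob m n (A : 'M[R]_(m, n)) :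
  frob A ^+ 2 = \sum_i \sum_j A i j ^+ 2.
Proof.
rewrite sqr_sqrtr//; apply: sumr_ge0 => i _; apply: sumr_ge0 => j _.
exact: sqr_ge0.
Qed.

Lemma frob0 m n : frob (0 : 'M[R]_(m, n)) = 0.
Proof.
apply/eqP; rewrite -sqrf_eq0 sqr_frob big1// => i _.
by rewrite big1// => j _; rewrite mxE expr0n.
Qed.

Lemma mxdotxx m n (A : 'M[R]_(m, n)) : mxdot A A = frob A ^+ 2.
Proof. by rewrite sqr_frob. Qed.

Lemma mxdotC m n (A B : 'M[R]_(m, n)) : mxdot A B = mxdot B A.
Proof. by apply: eq_bigr => i _; apply: eq_bigr => j _; apply: mulrC. Qed.

Lemma mxdot0r m n (A : 'M[R]_(m, n)) : mxdot A 0 = 0.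
Proof.
by rewrite /mxdot big1// => i _; rewrite big1// => j _; rewrite mxE mulr0.
Qed.

Lemma mxdotBl m n (A B C : 'M[R]_(m, n)) :
  mxdot (A - B) C = mxdot A C - mxdot B C.
Proof.
rewrite /mxdot -sumrB; apply: eq_bigr => i _; rewrite -sumrB.
by apply: eq_bigr => j _; rewrite !mxE mulrBl.
Qed.

Lemma normr_mxdot_le m n (A B : 'M[R]_(m, n)) :
  `|mxdot A B| <= frob A * frob B.
Proof.
rewrite -ler_sqr ?nnegrE ?mulr_ge0 ?frob_ge0// real_normK ?num_real//.
rewrite exprMn !sqr_frob /mxdot !pair_bigA/=.
exact: (@cauchy_schwarz _ _ (fun ij => A ij.1 ij.2) (fun ij => B ij.1 ij.2)).
Qed.

Lemma frobD m n (A B : 'M[R]_(m, n)) : frob (A + B) <= frob A + frob B.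
Proof.
rewrite -ler_sqr ?nnegrE ?addr_ge0 ?frob_ge0//.
have -> : frob (A + B) ^+ 2 = frob A ^+ 2 + mxdot A B *+ 2 + frob B ^+ 2.
  rewrite !sqr_frob /mxdot -sumrMnl -!big_split/=; apply: eq_bigr => i _.
  rewrite -sumrMnl -!big_split/=; apply: eq_bigr => j _.
  by rewrite !mxE sqrrD.
rewrite sqrrD lerD2r lerD2l ler_wMn2r//.
exact: le_trans (ler_norm _) (normr_mxdot_le A B).
Qed.

Lemma frobM m n p (A : 'M[R]_(m, n)) (B : 'M[R]_(n, p)) :
  frob (A *m B) <= frob A * frob B.
Proof.
rewrite -ler_sqr ?nnegrE ?mulr_ge0 ?frob_ge0// exprMn !sqr_frob.
rewrite [X in _ <= _ * X]exchange_big big_distrlr/=.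
apply: ler_sum => i _; apply: ler_sum => j _.
by rewrite mxE; apply: cauchy_schwarz.
Qed.

End Frobenius.

(** * Products with one or two factors replaced *)

Section Products.
Context {R : realFieldType}.

Section Scalar.
Context (n : nat) (w v : 'I_n -> R).

Definition prod1 (i : 'I_n) : R := \prod_(k | k != i) w k.
Definition prod2 (i j : 'I_n) : R := \prod_(k | (k != i) && (k != j)) w k.

(** [sum1] and [sum2] are the first and second derivatives at [t = 0] of
    [\prod_i (w i + t * v i)].  [sum2] runs over ordered pairs, hence each
    pair counts twice, as the second derivative requires. *)
Definition sum1 : R := \sum_i v i * prod1 i.
Definition sum2 : R := \sum_i \sum_(j | j != i) v i * v j * prod2 i j.

Lemma sum1_ge0 :
  (forall i, 0 <= w i) -> (forall i, 0 <= v i) -> 0 <= sum1.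
Proof.
by move=> w0 v0; apply: sumr_ge0 => i _; rewrite mulr_ge0// prodr_ge0.
Qed.

Lemma sum2_ge0 :
  (forall i, 0 <= w i) -> (forall i, 0 <= v i) -> 0 <= sum2.
Proof.
move=> w0 v0; apply: sumr_ge0 => i _; apply: sumr_ge0 => j _.
by rewrite !mulr_ge0// prodr_ge0.
Qed.

End Scalar.
End Products.

Section ProductsRec.
Context {R : realFieldType} (n : nat) (w v : 'I_n.+1 -> R).
Let low (f : 'I_n.+1 -> R) (i : 'I_n) := f (widen_ord (leqnSn n) i).

(** The recursions for [sum1] and [sum2] are the product rules obtained by
    splitting off the last factor; they match those of [dchain] and
    [ddchain]. *)
Lemma sum1_recr : sum1 w v =
  sum1 (low w) (low v) * w ord_max + (\prod_i low w i) * v ord_max.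
Proof.
have widen_max (i : 'I_n) : widen_ord (leqnSn n) i == ord_max = false.
  by apply/eqP => /(congr1 val)/= ni; have := ltn_ord i; rewrite ni ltnn.
rewrite /sum1 big_ord_recr/= mulr_suml; congr (_ + _).
  apply: eq_bigr => i _; rewrite -mulrA; congr (_ * _).
  rewrite /prod1 big_mkcond big_ord_recr/= eq_sym widen_max/=.
  by rewrite -big_mkcond.
rewrite mulrC; congr (_ * _); rewrite /prod1 big_mkcond big_ord_recr/= eqxx/=.
by rewrite mulr1; apply: eq_bigr => i _; rewrite widen_max.
Qed.

Lemma sum2_recr : sum2 w v =
  sum2 (low w) (low v) * w ord_max + sum1 (low w) (low v) * v ord_max *+ 2.
Proof.
have widen_max (i : 'I_n) : widen_ord (leqnSn n) i == ord_max = false.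
  by apply/eqP => /(congr1 val)/= ni; have := ltn_ord i; rewrite ni ltnn.
have max_widen (i : 'I_n) : ord_max == widen_ord (leqnSn n) i = false.
  by rewrite eq_sym.
have prod2C (i j : 'I_n.+1) : prod2 w i j = prod2 w j i.
  by apply: eq_bigl => k; rewrite andbC.
have prod2max (i : 'I_n) : prod2 w (widen_ord (leqnSn n) i) ord_max =
    prod1 (low w) i.
  rewrite /prod2 /prod1 big_mkcond big_ord_recr/= eqxx andbF mulr1.
  by rewrite [RHS]big_mkcond; apply: eq_bigr => k _; rewrite widen_max andbT.
rewrite /sum2 big_ord_recr/= mulr2n addrA; congr (_ + _).
  rewrite !mulr_suml -big_split/=; apply: eq_bigr => i _.
  rewrite big_mkcond big_ord_recr/= max_widen/=; congr (_ + _).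
    rewrite -big_mkcond mulr_suml; apply: eq_bigr => j ji.
    rewrite -[RHS]mulrA; congr (_ * _).
    rewrite /prod2 big_mkcond big_ord_recr/= !max_widen/=.
    by rewrite -big_mkcond.
  by rewrite prod2max mulrAC.
rewrite big_mkcond big_ord_recr/= eqxx addr0 mulr_suml.
apply: eq_bigr => i _; rewrite widen_max/= prod2C prod2max /low.
by ring.
Qed.

End ProductsRec.

(** * Bounds from the arithmetic-geometric mean inequality *)

Section Estimates.
Context {R : realFieldType}.

Lemma sum_offdiag (n : nat) (a : 'I_n -> R) :
  \sum_i \sum_(j | j != i) a i * a j = (\sum_i a i) ^+ 2 - \sum_i a i ^+ 2.
Proof.
rewrite expr2 big_distrlr/= -sumrB; apply: eq_bigr => i _.
by rewrite [in RHS](bigD1 i)//= expr2 addrAC subrr add0r.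
Qed.

Lemma sqr_sum_le (n : nat) (a : 'I_n -> R) :
  (\sum_i a i) ^+ 2 <= n%:R * \sum_i a i ^+ 2.
Proof.
have := cauchy_schwarz (fun=> 1 : R) a.
under eq_bigr do rewrite mul1r.
under [X in _ <= X * _ -> _]eq_bigr do rewrite expr1n.
by rewrite sumr_const card_ord.
Qed.

(** The arithmetic-geometric mean inequality over [A], followed by an
    enlargement of the sum to all indices, so that the bound no longer depends
    on which factors are omitted.  For empty [A] both sides are 1. *)
Lemma sqr_prod_le (n : nat) (A : {pred 'I_n}) (w : 'I_n -> R) :
  (\prod_(i in A) w i) ^+ 2 <= ((\sum_i w i ^+ 2) / #|A|%:R) ^+ #|A|.
Proof.
rewrite -prodrXl; apply: (@le_trans _ _
    (((\sum_(i in A) w i ^+ 2) / #|A|%:R) ^+ #|A|)).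
  by apply: (leif_AGM _).1 => i _; apply: sqr_ge0.
have sq0 i : 0 <= w i ^+ 2 by apply: sqr_ge0.
apply: lerXn2r; rewrite ?nnegrE ?divr_ge0 ?sumr_ge0// ler_wpM2r ?invr_ge0//.
by rewrite big_mkcond; apply: ler_sum => i _; case: ifP.
Qed.

Section Factors.
Context (n : nat) (w v : 'I_n -> R).
Let s := \sum_i w i ^+ 2.
Let S := \sum_i v i ^+ 2.

Lemma sqr_prod1_le i : prod1 w i ^+ 2 <= (s / (n.-1)%:R) ^+ n.-1.
Proof.
have := sqr_prod_le (predC1 i) w.
by rewrite cardC1 card_ord.
Qed.

Lemma sqr_prod2_le i j : j != i ->
  prod2 w i j ^+ 2 <= (s / (n - 2)%:R) ^+ (n - 2).
Proof.
move=> ji; have := sqr_prod_le [predD1 predC1 j & i] w.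
suff -> : #|[predD1 predC1 j & i]| = (n - 2)%N by [].
have := cardD1 i (predC1 j); rewrite cardC1 card_ord inE/= eq_sym ji/=.
by move=> cardE; rewrite -[LHS](addKn 1) -cardE -!subn1 -subnDA.
Qed.

Lemma sqr_sum1_le : sum1 w v ^+ 2 <= n%:R * (s / (n.-1)%:R) ^+ n.-1 * S.
Proof.
apply: le_trans (cauchy_schwarz _ _) _; rewrite mulrC.
apply: ler_wpM2r; first by apply: sumr_ge0 => i _; apply: sqr_ge0.
apply: (@le_trans _ _ (\sum_(i < n) (s / (n.-1)%:R) ^+ n.-1)).
  by apply: ler_sum => i _; apply: sqr_prod1_le.
by rewrite sumr_const card_ord mulr_natl.
Qed.

(** For [i != j], multiplying the product that omits [i] and [j] by the full
    product gives the product of the two products that omit one index, so the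
    left side is the off-diagonal part of [sum1 ^+ 2]. *)
Lemma prodM_sum2 : (\prod_i w i) * sum2 w v =
  sum1 w v ^+ 2 - \sum_i (v i * prod1 w i) ^+ 2.
Proof.
rewrite -sum_offdiag /sum2 mulr_sumr; apply: eq_bigr => i _.
rewrite mulr_sumr; apply: eq_bigr => j ji.
suff E : (\prod_k w k) * prod2 w i j = prod1 w i * prod1 w j.
  by rewrite mulrACA -E mulrCA.
rewrite (bigD1 i)//= -/(prod1 w i) mulrAC mulrC; congr (_ * _).
rewrite /prod1 [RHS](bigD1 i) 1?eq_sym//=; congr (_ * _).
by apply: eq_bigl => k; rewrite andbC.
Qed.

(** Off-diagonal parts cost a factor [1 - 1 / n] by [sqr_sum_le], whence the
    [2 n - 1].  What the mean inequality gives has [n.-1 ^+ n.-1] in the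
    denominator where the stated bound has [n! / n]. *)
Lemma sum1_sum2_le : (2 <= n)%N ->
  sum1 w v ^+ 2 + (\prod_i w i) * sum2 w v <=
  (2 * n%:R - 1) * n%:R ^+ n / n`!%:R * (s / n%:R) ^+ n.-1 * S.
Proof.
move=> n2; have n0 : 0 < n%:R :> R by rewrite ltr0n ltnW.
have n'0 : 0 < (n.-1)%:R :> R by rewrite ltr0n -subn1 subn_gt0.
rewrite prodM_sum2.
apply: (@le_trans _ _ ((2 * n%:R - 1) / n%:R * sum1 w v ^+ 2)).
  rewrite mulrBl mul1r mulfK ?gt_eqF// mulrBl mulr_natl mulr2n -addrA.
  rewrite lerD2l lerD2l lerN2 ler_pdivrMl//.
  exact: (sqr_sum_le (fun i => v i * prod1 w i)).
have n21 : 0 <= 2 * n%:R - 1 :> R.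
  by rewrite subr_ge0 -natrM ler1n muln_gt0 /= ltnW.
have S0 : 0 <= S by apply: sumr_ge0 => i _; apply: sqr_ge0.
have s0 : 0 <= s by apply: sumr_ge0 => i _; apply: sqr_ge0.
apply: (le_trans (ler_wpM2l _ sqr_sum1_le)); first by rewrite divr_ge0// ltW.
have -> : (2 * n%:R - 1) / n%:R * (n%:R * (s / n.-1%:R) ^+ n.-1 * S) =
    (2 * n%:R - 1) * (s / n.-1%:R) ^+ n.-1 * S.
  by field; rewrite gt_eqF.
apply: ler_wpM2r => //; rewrite -!mulrA; apply: ler_wpM2l => //.
(* Both sides are multiples of s ^+ n.-1; it remains to compare n! with
   n * n.-1 ^+ n.-1. *)
have fact_le m : (m`! <= m ^ m)%N.
  have -> : (m ^ m = \prod_(1 <= i < m.+1) m)%N.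
    by rewrite prod_nat_const_nat subn1.
  rewrite fact_prod big_nat_cond [leqRHS]big_nat_cond.
  by apply: leq_prod => i /andP[/andP[]].
have nE : n = n.-1.+1 by rewrite prednK// ltnW.
have powE : n%:R ^+ n = n%:R * n%:R ^+ n.-1 :> R by rewrite -exprS -nE.
have factE : n`! = (n * (n.-1)`!)%N by rewrite [in LHS]nE factS -nE.
rewrite !expr_div_n.
rewrite [leRHS](_ : _ = s ^+ n.-1 * (n%:R / n`!%:R)); last first.
  rewrite powE; field.
  by rewrite expf_neq0 ?gt_eqF//= andbT gt_eqF// ltr0n fact_gt0.
apply: ler_wpM2l; first exact: exprn_ge0.
rewrite factE natrM invfM mulrA divff ?gt_eqF// mul1r.
by rewrite lef_pV2 ?posrE ?exprn_gt0// ?ltr0n ?fact_gt0// -natrX ler_nat.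
Qed.

(** As [n] is even, the bound on the squares of the products is itself a
    square, and nonnegativity of the [w i] allows extracting the root. *)
Lemma sum2_le : ~~ odd n -> (forall i, 0 <= w i) -> (forall i, 0 <= v i) ->
  (2 <= n)%N ->
  sum2 w v <= (n%:R - 1) * (s / (n - 2)%:R) ^+ (n - 2)./2 * S.
Proof.
move=> neven w0 v0 n2.
have s0 : 0 <= s by apply: sumr_ge0 => i _; apply: sqr_ge0.
have prod2_le i j : j != i -> prod2 w i j <= (s / (n - 2)%:R) ^+ (n - 2)./2.
  move=> ji; rewrite -ler_sqr ?nnegrE ?exprn_ge0 ?divr_ge0 ?prodr_ge0//.
  rewrite -exprM muln2 halfK oddB// (negbTE neven) subn0.
  exact: sqr_prod2_le.
set C := (s / _) ^+ _ in prod2_le *.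
have C0 : 0 <= C by rewrite exprn_ge0// divr_ge0.
apply: (@le_trans _ _ (\sum_i \sum_(j | j != i) v i * v j * C)).
  apply: ler_sum => i _; apply: ler_sum => j ji.
  by apply: ler_wpM2l; rewrite ?mulr_ge0// prod2_le.
under eq_bigr do rewrite -mulr_suml.
rewrite -mulr_suml sum_offdiag [leRHS]mulrAC; apply: ler_wpM2r => //.
by rewrite mulrBl mul1r lerD2r; apply: sqr_sum_le.
Qed.

End Factors.
End Estimates.

(** * Convexity from the second derivative *)

Section Convexity.
Context {R : realType}.

Lemma is_derive_line (V : normedModType R) (f : V -> R) (x v : V) (t d : R) :
  is_derive (x + t *: v) v f d ->
  is_derive t (1 : R) (fun s : R => f (x + s *: v)) d.
Proof.
move=> [fder <-].
have quotE : (fun h : R => h^-1 *: (((fun s : R => f (x + s *: v)) \o shift t)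
    (h *: (1 : R)) - f (x + t *: v))) =
    (fun h => h^-1 *: ((f \o shift (x + t *: v)) (h *: v) - f (x + t *: v))).
  apply/funext => h; rewrite /= [_%:A]mulr1; congr (_ *: (f _ - _)).
  by rewrite scalerDl addrCA.
by split; rewrite /derivable /derive quotE.
Qed.

(** The mean value theorem along the segment from [x] to [x + v], applied to
    [f] and then to its derivative in the direction [v]. *)
Lemma ge_tangent (V : normedModType R) (f : V -> R) (df ddf : V -> V -> R) :
  (forall x v, is_derive x v f (df v x)) ->
  (forall x v, is_derive x v (df v) (ddf v x)) ->
  (forall x v, 0 <= ddf v x) ->
  forall x v, f x + df v x <= f (x + v).
Proof.
move=> fdf dfddf ddf0 x v.
pose F t := f (x + t *: v); pose dF t := df v (x + t *: v).
have FdF t : is_derive t (1 : R) F (dF t) by apply: is_derive_line.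
have dFddF t : is_derive t (1 : R) dF (ddf v (x + t *: v)).
  exact: is_derive_line.
have cont (h dh : R -> R) a b : (forall t, is_derive t (1 : R) h (dh t)) ->
    {within `[a, b], continuous h}.
  move=> hdh; apply: derivable_within_continuous => t _.
  by have [] := hdh t.
have [c] := @MVT_segment R F dF 0 1 ler01 (fun t _ => FdF t) (cont _ _ _ _ FdF).
rewrite subr0 mulr1 in_itv/= => /andP[c0 _] F01.
have [e _] := @MVT_segment R dF _ 0 c c0 (fun t _ => dFddF t)
  (cont _ _ _ _ dFddF).
rewrite subr0 => dF0c.
have -> : x + v = x + 1 *: v by rewrite scale1r.
rewrite -/(F 1) -[F 1](subrK (F 0)) F01 /F scale0r addr0 addrC lerD2r.
have := mulr_ge0 (ddf0 (x + e *: v) v) c0.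
by rewrite -dF0c subr_ge0 /dF scale0r addr0.
Qed.

(** Averaging the tangent inequalities at the intermediate point [z] towards
    [x] and [y] with weights [t] and [1 - t] cancels the first-order terms,
    since [x - z] and [y - z] are multiples of [x - y] and the differential is
    linear. *)
Lemma jensen_of_tangent (V : normedModType R) (f : V -> R) :
  (forall x, differentiable f x) ->
  (forall x v, f x + 'D_v f x <= f (x + v)) ->
  forall x y (t : R), 0 <= t <= 1 ->
    f (t *: x + (1 - t) *: y) <= t * f x + (1 - t) * f y.
Proof.
move=> fdiff ftan x y t /andP[t0 t1].
set z := t *: x + (1 - t) *: y.
have := ftan z ((1 - t) *: (x - y)); have := ftan z ((- t) *: (x - y)).
rewrite !deriveE// !linearZ/=.
have -> : z + (1 - t) *: (x - y) = x.
  rewrite /z scalerBr addrACA -scalerDl subrKC scale1r.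
  by rewrite subrr addr0.
have -> : z + (- t) *: (x - y) = y.
  rewrite /z scalerBr addrACA -scalerDl subrr scale0r add0r -scalerBl.
  by rewrite opprK addrC subrKC scale1r.
set D := 'd f z _; move=> Hy Hx.
have t1' : 0 <= 1 - t by rewrite subr_ge0.
have := lerD (ler_wpM2l t0 Hx) (ler_wpM2l t1' Hy).
apply: le_trans; rewrite le_eqVlt; apply/orP; left; apply/eqP.
rewrite /GRing.scale/=; ring.
Qed.

End Convexity.

(** * Polynomial functions of finitely many coordinates *)

Section Polyfun.
Context {R : realType} {m : nat}.
Local Notation E := 'rV[R]_m.

(** Closed under directional derivatives, this class reduces continuous
    differentiability to a structural induction. *)
Inductive polyfun : (E -> R) -> Prop :=
| polyfun_cst c : polyfun (fun=> c)
| polyfun_coord j : polyfun (fun x => x ord0 j)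
| polyfunD f g : polyfun f -> polyfun g -> polyfun (fun x => f x + g x)
| polyfunM f g : polyfun f -> polyfun g -> polyfun (fun x => f x * g x).

Lemma polyfun_sum (I : Type) (r : seq I) (f : I -> E -> R) :
  (forall i, polyfun (f i)) -> polyfun (fun x => \sum_(i <- r) f i x).
Proof.
move=> fpoly; elim: r => [|i r IHr].
  by under eq_fun do rewrite big_nil; apply: polyfun_cst.
by under eq_fun do rewrite big_cons; apply: polyfunD.
Qed.

Lemma polyfunX (f : E -> R) n : polyfun f -> polyfun (fun x => f x ^+ n).
Proof.
move=> fpoly; elim: n => [|n IHn].
  by under eq_fun do rewrite expr0; apply: polyfun_cst.
by under eq_fun do rewrite exprS; apply: polyfunM.
Qed.

Lemma is_derive_coord (x v : E) j :
  is_derive x v (fun y : E => y ord0 j : R) (v ord0 j).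
Proof.
split; first exact/diff_derivable/differentiable_coord.
have := derive_mx (@derivable_id _ _ x v).
by rewrite derive_id => /matrixP/(_ ord0 j); rewrite mxE => ->.
Qed.

Lemma polyfun_differentiable f : polyfun f -> forall x, differentiable f x.
Proof.
elim=> {f} [c|j|f g _ df _ dg|f g _ df _ dg] x.
- exact: differentiable_cst.
- exact: differentiable_coord.
- exact: differentiableD.
- exact: differentiableM.
Qed.

Lemma polyfun_derive f v : polyfun f -> polyfun (fun x => 'D_v f x).
Proof.
elim=> {f} [c|j|f g pf Df pg Dg|f g pf Df pg Dg].
- by under eq_fun do rewrite derive_cst; apply: polyfun_cst.
- under eq_fun => x do
    rewrite (@derive_val _ _ _ _ _ _ _ (is_derive_coord x v j)).
  exact: polyfun_cst.
- have -> : (fun x => 'D_v (fun y => f y + g y) x) =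
      (fun x => 'D_v f x + 'D_v g x).
    by apply/funext => x; rewrite deriveD//;
      apply/diff_derivable/polyfun_differentiable.
  exact: polyfunD.
- have -> : (fun x => 'D_v (fun y => f y * g y) x) =
      (fun x => f x * 'D_v g x + g x * 'D_v f x).
    by apply/funext => x; rewrite deriveM//;
      apply/diff_derivable/polyfun_differentiable.
  by apply: polyfunD; apply: polyfunM.
Qed.

Lemma polyfun_C1 f : polyfun f -> C1_on setT f.
Proof.
move=> pf; split=> x _; first exact: polyfun_differentiable.
have -> : gradient f = \sum_(j < m)
    (fun y : E => 'D_(delta_mx ord0 j) f y *: (delta_mx ord0 j : E)).
  apply/funext => y; rewrite fct_sumE [LHS]row_sum_delta.
  by apply: eq_bigr => j _; rewrite mxE.
apply: differentiable_continuous; apply: differentiable_sum => j.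
exact/differentiableZl/polyfun_differentiable/polyfun_derive.
Qed.

Lemma polyfun_mxdot k n (A B : E -> 'M[R]_(k, n)) :
  (forall i j, polyfun (fun W => A W i j)) ->
  (forall i j, polyfun (fun W => B W i j)) ->
  polyfun (fun W => mxdot (A W) (B W)).
Proof.
by move=> pA pB; do 2 apply: polyfun_sum => ?; apply: polyfunM.
Qed.

Lemma polyfun_mxM k n p (A : E -> 'M[R]_(k, n)) (B : E -> 'M[R]_(n, p)) :
  (forall i j, polyfun (fun W => A W i j)) ->
  (forall i j, polyfun (fun W => B W i j)) ->
  forall i j, polyfun (fun W => (A W *m B W) i j).
Proof.
move=> pA pB i j; under eq_fun do rewrite mxE.
by apply: polyfun_sum => l; apply: polyfunM.
Qed.

End Polyfun.

(** * Kernel generating distances on the whole space *)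

Section Kernel.
Context {R : realType} {m : nat}.
Local Notation E := 'rV[R]_m.

Lemma convex_of_tangent (f : E -> R) : (forall x, differentiable f x) ->
  (forall x v, f x + 'D_v f x <= f (x + v)) -> @convex_function R E setT f.
Proof.
move=> fdiff ftan t x y _ _.
by apply: (jensen_of_tangent fdiff ftan); rewrite ge0 le1.
Qed.

Lemma derive_dotprod_gradient (f : E -> R) (x v : E) : differentiable f x ->
  'D_v f x = dotprod (gradient f x) v.
Proof.
move=> fdiff; rewrite deriveE// [v in LHS]row_sum_delta linear_sum/=.
by apply: eq_bigr => j _; rewrite linearZ/= mxE deriveE// mulrC.
Qed.

(** A finite function has full domain, and the tangent inequality says that the
    gradient is a subgradient at every point; the remaining conditions are
    continuity and Jensen's inequality. *)
Lemma kernel_of_tangent (f : E -> R) : C1_on setT f ->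
  (forall x v, f x + 'D_v f x <= f (x + v)) ->
  kernel_generating_distance [set: E] (fun x => (f x)%:E).
Proof.
move=> fC1 ftan; have fdiff x : differentiable f x by apply: fC1.1.
have edomT : edom (fun x => (f x)%:E) = setT.
  by apply/seteqP; split=> x //= _; rewrite /edom/= ltry.
split; [|split].
- split; [by exists 0|by move=> x y t _ _; rewrite inE|exact: openT].
- split.
  + split=> [x|]; first exact: ltNyr.
    by rewrite edomT; exists 0.
  + move=> x a; rewrite lte_fin => afx; exists [set y | a < f y].
      have := differentiable_continuous (fdiff x) => /cvgr_gt; exact.
    by move=> y; rewrite lte_fin.
  + move=> x y t t01; rewrite -!EFinM -EFinD lee_fin.
    exact: jensen_of_tangent.
- split=> //.
  + by rewrite closureT.
  + apply/seteqP; split=> x // _; exists (gradient f x); split.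
      by rewrite edomT.
    move=> y; rewrite -EFinD lee_fin -derive_dotprod_gradient//.
    by have := ftan x (y - x); rewrite subrKC.
  + by rewrite edomT interiorT.
Qed.

End Kernel.

(** * Derivatives of matrix expressions *)

Section BilinearDerivatives.
Context {R : realType} {U : normedModType R} (x v : U).

Lemma is_derive_lincomb (f g : U -> R) (a b df dg : R) :
  is_derive x v f df -> is_derive x v g dg ->
  is_derive x v (fun y => a * f y + b * g y) (a * df + b * dg).
Proof.
by move=> fdf gdg; apply: (is_deriveD (is_deriveZ a fdf) (is_deriveZ b gdg)).
Qed.

Lemma is_derive_bigsum n (h : 'I_n -> U -> R) (dh : 'I_n -> R) :
  (forall i, is_derive x v (h i) (dh i)) ->
  is_derive x v (fun y => \sum_i h i y) (\sum_i dh i).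
Proof.
move=> hdh; have -> : (fun y => \sum_i h i y) = \sum_i h i.
  by apply/funext => y; rewrite fct_sumE.
exact: is_derive_sum.
Qed.

(** Entrywise, so that the rules for real-valued functions apply directly. *)
Definition is_derive_mx m n (A : U -> 'M[R]_(m, n)) (dA : 'M[R]_(m, n)) :=
  forall i j, is_derive x v (fun y => A y i j) (dA i j).

Lemma is_derive_mxcst m n (A : 'M[R]_(m, n)) : is_derive_mx (fun=> A) 0.
Proof.
by move=> i j; rewrite [X in is_derive _ _ _ X]mxE; apply: is_derive_cst.
Qed.

Lemma is_derive_mxM m n p (A : U -> 'M[R]_(m, n)) (B : U -> 'M[R]_(n, p))
    dA dB :
  is_derive_mx A dA -> is_derive_mx B dB ->
  is_derive_mx (fun y => A y *m B y) (dA *m B x + A x *m dB).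
Proof.
move=> AdA BdB i j; under eq_fun do rewrite mxE.
rewrite !mxE -big_split/=; apply: is_derive_bigsum => k.
apply: is_derive_eq (is_deriveM (AdA i k) (BdB k j)) _.
by rewrite addrC; congr (_ + _); exact: mulrC.
Qed.

Lemma is_derive_mxdot m n (A B : U -> 'M[R]_(m, n)) dA dB :
  is_derive_mx A dA -> is_derive_mx B dB ->
  is_derive x v (fun y => mxdot (A y) (B y)) (mxdot dA (B x) + mxdot (A x) dB).
Proof.
move=> AdA BdB; rewrite /mxdot -big_split/=.
apply: is_derive_bigsum => i; rewrite -big_split/=.
apply: is_derive_bigsum => j.
apply: is_derive_eq (is_deriveM (AdA i j) (BdB i j)) _.
by rewrite addrC; congr (_ + _); exact: mulrC.
Qed.

End BilinearDerivatives.

(** * Chains of matrix products *)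

Section Chain.
Context {R : realType} (d : nat -> nat).

Definition layers n := forall i : 'I_n, 'M[R]_(d i, d i.+1).

Definition init_layers n (W : layers n.+1) : layers n :=
  fun i => W (widen_ord (leqnSn n) i).

(** [dchain W V] and [ddchain W V] are the first and second derivatives of
    [chainmx] at [W] in the direction [V]; the recursions are the product
    rule on the last factor.  There is no term with two derivatives on the
    last factor, as the layers are affine along [V]. *)
Fixpoint dchain n : layers n -> layers n -> 'M[R]_(d 0, d n) :=
  match n with
  | 0 => fun _ _ => 0
  | n'.+1 => fun W V =>
      dchain (init_layers W) (init_layers V) *m W ord_max +
      chainmx (init_layers W) *m V ord_max
  end.

Fixpoint ddchain n : layers n -> layers n -> 'M[R]_(d 0, d n) :=
  match n with
  | 0 => fun _ _ => 0
  | n'.+1 => fun W V =>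
      ddchain (init_layers W) (init_layers V) *m W ord_max +
      dchain (init_layers W) (init_layers V) *m V ord_max *+ 2
  end.

Section Derivatives.
Context {U : normedModType R} (x v : U).

Lemma is_derive_chainmx n (W : U -> layers n) (V : layers n) :
  (forall i, is_derive_mx x v (fun y => W y i) (V i)) ->
  is_derive_mx x v (fun y => chainmx (W y)) (dchain (W x) V).
Proof.
elim: n W V => [|n IHn] W V WV; first exact: is_derive_mxcst.
have WV' i : is_derive_mx x v (fun y => init_layers (W y) i)
    (init_layers V i) by exact: (WV (widen_ord (leqnSn n) i)).
exact: is_derive_mxM (IHn _ _ WV') (WV ord_max).
Qed.

Lemma is_derive_dchain n (W : U -> layers n) (V : layers n) :
  (forall i, is_derive_mx x v (fun y => W y i) (V i)) ->
  is_derive_mx x v (fun y => dchain (W y) V) (ddchain (W x) V).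
Proof.
elim: n W V => [|n IHn] W V WV; first exact: is_derive_mxcst.
have WV' i : is_derive_mx x v (fun y => init_layers (W y) i)
    (init_layers V i) by exact: (WV (widen_ord (leqnSn n) i)).
have D1 := is_derive_mxM (IHn _ _ WV') (WV ord_max).
have D2 := is_derive_mxM (is_derive_chainmx WV')
  (is_derive_mxcst x v (V ord_max)).
move=> i j /=; under eq_fun do rewrite mxE.
apply: is_derive_eq (is_deriveD (D1 i j) (D2 i j)) _.
by rewrite mulmx0 addr0 mulr2n addrA [RHS]mxE.
Qed.

End Derivatives.

Section Norms.

(** Bounding [chainmx W *m B] instead of [chainmx W] makes the empty chain
    harmless: the identity matrix has Frobenius norm greater than 1 in
    general. *)
Lemma frob_chainmx_le n p (W : layers n) (B : 'M[R]_(d n, p)) :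
  frob (chainmx W *m B) <= (\prod_i frob (W i)) * frob B.
Proof.
elim: n W B => [|n IHn] W B /=; first by rewrite mul1mx big_ord0 mul1r.
rewrite -mulmxA big_ord_recr/= -mulrA.
apply: le_trans (IHn _ _) _; apply: ler_wpM2l; last exact: frobM.
by apply: prodr_ge0 => i _; apply: frob_ge0.
Qed.

Lemma frob_dchain_le n p (W V : layers n) (B : 'M[R]_(d n, p)) :
  frob (dchain W V *m B) <=
  sum1 (fun i => frob (W i)) (fun i => frob (V i)) * frob B.
Proof.
elim: n W V B => [|n IHn] W V B /=.
  by rewrite mul0mx frob0 /sum1 big_ord0 mul0r.
rewrite mulmxDl -!mulmxA sum1_recr mulrDl -!mulrA.
apply: le_trans (frobD _ _) _; apply: lerD.
- apply: le_trans (IHn _ _ _) _; apply: ler_wpM2l; last exact: frobM.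
  by apply: sum1_ge0 => i; apply: frob_ge0.
- apply: le_trans (frob_chainmx_le _ _) _; apply: ler_wpM2l; last exact: frobM.
  by apply: prodr_ge0 => i _; apply: frob_ge0.
Qed.

Lemma frob_ddchain_le n p (W V : layers n) (B : 'M[R]_(d n, p)) :
  frob (ddchain W V *m B) <=
  sum2 (fun i => frob (W i)) (fun i => frob (V i)) * frob B.
Proof.
elim: n W V B => [|n IHn] W V B /=.
  by rewrite mul0mx frob0 /sum2 big_ord0 mul0r.
rewrite mulmxDl !mulr2n mulmxDl -!mulmxA sum2_recr mulr2n !mulrDl -!mulrA.
have le1 : frob (dchain (init_layers W) (init_layers V) *m (V ord_max *m B)) <=
    sum1 (fun i => frob (init_layers W i)) (fun i => frob (init_layers V i)) *
    (frob (V ord_max) * frob B).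
  apply: le_trans (frob_dchain_le _ _ _) _; apply: ler_wpM2l; last exact: frobM.
  by apply: sum1_ge0 => i; apply: frob_ge0.
apply: le_trans (frobD _ _) _; apply: lerD.
- apply: le_trans (IHn _ _ _) _; apply: ler_wpM2l; last exact: frobM.
  by apply: sum2_ge0 => i; apply: frob_ge0.
- by apply: le_trans (frobD _ _) _; apply: lerD.
Qed.

End Norms.
End Chain.

(** * The objective and the powers of the norm *)

Section Objective.
Context {R : realType} (N : nat) (d : nat -> nat).
Local Notation E := (@wspace R d N).

Definition layer_index (i : 'I_N) (a : 'I_(d i)) (b : 'I_(d i.+1)) :=
  @tagnat.Rank N (fun i => d i * d i.+1)%N i (mxvec_index a b).

Lemma layerE (W : E) i a b : layer W i a b = W ord0 (layer_index a b).
Proof. by rewrite !mxE. Qed.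

(** Each layer is linear in the parameter vector: its entries are
    coordinates. *)
Lemma is_derive_layer (W V : E) i :
  is_derive_mx W V (fun y => layer y i) (layer V i).
Proof.
move=> a b; rewrite layerE.
have -> : (fun y : E => layer y i a b) = (fun y => y ord0 (layer_index a b)).
  by apply/funext => y; rewrite layerE.
exact: is_derive_coord.
Qed.

(** The squared norm without the square root, which would hide that it is
    polynomial. *)
Definition sqnorm (W : E) : R := \sum_i mxdot (layer W i) (layer W i).

Lemma sqnormE (W : E) : sqnorm W = \sum_i frob (layer W i) ^+ 2.
Proof. by apply: eq_bigr => i _; rewrite mxdotxx. Qed.

Lemma sqnorm_ge0 (W : E) : 0 <= sqnorm W.
Proof. by rewrite sqnormE sumr_ge0// => i _; apply: sqr_ge0. Qed.

Lemma sqr_wnorm (W : E) : wnorm W ^+ 2 = sqnorm W.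
Proof. by rewrite sqnormE sqr_sqrtr// -sqnormE sqnorm_ge0. Qed.

Definition dsqnorm (V W : E) : R := (\sum_i mxdot (layer W i) (layer V i)) *+ 2.

Lemma is_derive_sqnorm (W V : E) : is_derive W V sqnorm (dsqnorm V W).
Proof.
apply: is_derive_eq (is_derive_bigsum (fun i => is_derive_mxdot
  (@is_derive_layer W V i) (@is_derive_layer W V i))) _.
rewrite /dsqnorm -sumrMnl; apply: eq_bigr => i _.
by rewrite mulr2n [X in X + _ = _]mxdotC.
Qed.

Lemma is_derive_dsqnorm (W V : E) :
  is_derive W V (dsqnorm V) (sqnorm V *+ 2).
Proof.
have D := is_derive_bigsum (fun i => is_derive_mxdot
  (@is_derive_layer W V i) (is_derive_mxcst W V (layer V i))).
have -> : dsqnorm V = (fun y => \sum_i mxdot (layer y i) (layer V i)) +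
    (fun y => \sum_i mxdot (layer y i) (layer V i)).
  by apply/funext => y; rewrite /dsqnorm mulr2n.
apply: is_derive_eq (is_deriveD D D) _; rewrite -mulr2n; congr (_ *+ 2).
by apply: eq_bigr => i _; rewrite mxdot0r addr0.
Qed.

Section NormPower.
Context (n : nat).

(** [H1] and [H2] are [normpow N] and [normpow N./2]. *)
Definition normpow (W : E) : R := (sqnorm W / N%:R) ^+ n.

Definition dnormpow (V W : E) : R :=
  n%:R * (sqnorm W / N%:R) ^+ n.-1 * (dsqnorm V W / N%:R).

Definition ddnormpow (V W : E) : R :=
  n%:R * ((n.-1)%:R * (sqnorm W / N%:R) ^+ n.-2 * (dsqnorm V W / N%:R) ^+ 2 +
          (sqnorm W / N%:R) ^+ n.-1 * (sqnorm V *+ 2 / N%:R)).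

Lemma is_derive_divN (W V : E) (f : E -> R) df : is_derive W V f df ->
  is_derive W V (fun y => f y / N%:R) (df / N%:R).
Proof.
move=> fdf; apply: is_derive_eq (is_deriveM fdf (is_derive_cst _ _ _)) _.
by rewrite scaler0 add0r; exact: mulrC.
Qed.

Lemma is_derive_normpow (W V : E) : is_derive W V normpow (dnormpow V W).
Proof.
have -> : normpow = (fun y => sqnorm y / N%:R) ^+ n.
  by apply/funext => y; rewrite exprfctE.
exact: (is_deriveX n (is_derive_divN (is_derive_sqnorm W V))).
Qed.

Lemma is_derive_dnormpow (W V : E) :
  is_derive W V (dnormpow V) (ddnormpow V W).
Proof.
have Dpow := is_deriveX n.-1 (is_derive_divN (is_derive_sqnorm W V)).
have D := is_deriveM Dpow (is_derive_divN (is_derive_dsqnorm W V)).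
have -> : dnormpow V = n%:R *: (((fun y => sqnorm y / N%:R) ^+ n.-1) *
    (fun y => dsqnorm V y / N%:R)).
  by apply/funext => y; rewrite /dnormpow -mulrA exprfctE.
apply: is_derive_eq (is_deriveZ n%:R D) _.
rewrite /ddnormpow /GRing.scale/=; congr (_ * _).
by rewrite exprfctE; ring.
Qed.

(** The discarded term is a nonnegative multiple of [<W, V> ^+ 2]. *)
Lemma ddnormpow_ge (V W : E) :
  n%:R * (sqnorm W / N%:R) ^+ n.-1 * (sqnorm V *+ 2 / N%:R) <= ddnormpow V W.
Proof.
rewrite /ddnormpow -mulrA; apply: ler_wpM2l => //; rewrite lerDr.
have q0 : 0 <= sqnorm W / N%:R by rewrite divr_ge0// sqnorm_ge0.
by apply: mulr_ge0; [rewrite mulr_ge0// exprn_ge0 | apply: sqr_ge0].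
Qed.

End NormPower.

Section Fit.
Context (nT : nat) (X : 'M[R]_(d N, nT)) (Y : 'M[R]_(d 0, nT)).

Definition residual (W : E) := chainmx (layer W) *m X - Y.

Definition dobjective (V W : E) : R :=
  mxdot (residual W) (dchain (layer W) (layer V) *m X).

Definition ddobjective (V W : E) : R :=
  mxdot (dchain (layer W) (layer V) *m X) (dchain (layer W) (layer V) *m X) +
  mxdot (residual W) (ddchain (layer W) (layer V) *m X).

Lemma objectiveE (W : E) :
  objective X Y W = 2^-1 * mxdot (residual W) (residual W).
Proof. by rewrite mxdotxx. Qed.

Lemma is_derive_residual (W V : E) :
  is_derive_mx W V residual (dchain (layer W) (layer V) *m X).
Proof.
have D := is_derive_mxM
  (is_derive_chainmx (is_derive_layer W V)) (is_derive_mxcst W V X).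
move=> i j; have -> : (fun y => residual y i j) =
    (fun y => (chainmx (layer y) *m X) i j) - cst (Y i j).
  by apply/funext => y; rewrite /residual mxE [X in _ + X]mxE.
apply: is_derive_eq (is_deriveB (D i j) (is_derive_cst _ _ _)) _.
by rewrite subr0 mulmx0 addr0.
Qed.

Lemma is_derive_objective (W V : E) :
  is_derive W V (objective X Y) (dobjective V W).
Proof.
have D := is_derive_mxdot (is_derive_residual W V) (is_derive_residual W V).
have -> : objective X Y =
    2^-1 *: ((fun y => mxdot (residual y) (residual y)) : E -> R).
  by apply/funext => y; rewrite objectiveE.
apply: is_derive_eq (is_deriveZ 2^-1 D) _.
rewrite [X in X + _]mxdotC -/(dobjective V W) /GRing.scale/=.
by field.
Qed.

Lemma is_derive_dobjective (W V : E) :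
  is_derive W V (dobjective V) (ddobjective V W).
Proof.
have Ddchain := is_derive_mxM
  (is_derive_dchain (is_derive_layer W V)) (is_derive_mxcst W V X).
apply: is_derive_eq (is_derive_mxdot (is_derive_residual W V) Ddchain) _.
by rewrite mulmx0 addr0.
Qed.

Lemma normr_ddobjective_le (V W : E)
    (w := fun i => frob (layer W i)) (v := fun i => frob (layer V i)) :
  `|ddobjective V W| <=
  frob X ^+ 2 * (sum1 w v ^+ 2 + (\prod_i w i) * sum2 w v) +
  frob Y * frob X * sum2 w v.
Proof.
have w0 i : 0 <= w i by apply: frob_ge0.
have v0 i : 0 <= v i by apply: frob_ge0.
have X0 := frob_ge0 X; have Y0 := frob_ge0 Y.
have P0 : 0 <= \prod_i w i by apply: prodr_ge0.
have b0 := frob_chainmx_le (layer W) X.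
have b1 := frob_dchain_le (layer W) (layer V) X.
have b2 := frob_ddchain_le (layer W) (layer V) X.
have term1 : `|mxdot (dchain (layer W) (layer V) *m X)
    (dchain (layer W) (layer V) *m X)| <= (sum1 w v * frob X) ^+ 2.
  rewrite (le_trans (normr_mxdot_le _ _))// -expr2.
  by rewrite lerXn2r ?nnegrE ?frob_ge0// mulr_ge0// sum1_ge0.
have term2 : `|mxdot (chainmx (layer W) *m X)
    (ddchain (layer W) (layer V) *m X)| <=
    (\prod_i w i * frob X) * (sum2 w v * frob X).
  by rewrite (le_trans (normr_mxdot_le _ _))// ler_pM ?frob_ge0.
have term3 : `|mxdot Y (ddchain (layer W) (layer V) *m X)| <=
    frob Y * (sum2 w v * frob X).
  by rewrite (le_trans (normr_mxdot_le _ _))// ler_pM ?frob_ge0.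
rewrite /ddobjective /residual mxdotBl.
apply: le_trans (ler_normD _ _) _.
apply: le_trans (lerD term1 (le_trans (ler_normB _ _) (lerD term2 term3))) _.
by rewrite le_eqVlt; apply/orP; left; apply/eqP; ring.
Qed.

End Fit.
End Objective.

(** * The kernel dominates the objective *)

Section Domination.
Context {R : realType} (N : nat) (d : nat -> nat) (nT : nat).
Context (X : 'M[R]_(d N, nT)) (Y : 'M[R]_(d 0, nT)).
Context (hN : (2 <= N)%N) (hNeven : ~~ odd N).
Local Notation E := (@wspace R d N).

Lemma HaE (W : E) :
  Ha X Y W = c1 X * normpow N W + c2 X Y * normpow N./2 W.
Proof. by rewrite /Ha /H1 /H2 !sqr_wnorm. Qed.

Definition dHa (V W : E) : R :=
  c1 X * dnormpow N V W + c2 X Y * dnormpow N./2 V W.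

Definition ddHa (V W : E) : R :=
  c1 X * ddnormpow N V W + c2 X Y * ddnormpow N./2 V W.

Lemma c1_ge0 : 0 <= c1 X.
Proof.
rewrite mulr_ge0 ?sqr_ge0// divr_ge0// mulr_ge0 ?exprn_ge0//.
by rewrite subr_ge0 -natrM ler1n muln_gt0 /= ltnW.
Qed.

Lemma c2_ge0 : 0 <= c2 X Y.
Proof.
rewrite divr_ge0// ?exprn_ge0// ?subr_ge0 ?ler_nat//.
by rewrite !mulr_ge0 ?frob_ge0 ?exprn_ge0// subr_ge0 ler1n ltnW.
Qed.

(** The constants [c1] and [c2] are those that make the bounds of
    [sum1_sum2_le] and [sum2_le] coincide with the lower bounds of
    [ddnormpow_ge] for the exponents [N] and [N / 2]. *)
Lemma c1_bound (s S : R) :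
  frob X ^+ 2 * ((2 * N%:R - 1) * N%:R ^+ N / N`!%:R * (s / N%:R) ^+ N.-1 * S) =
  c1 X * (N%:R * (s / N%:R) ^+ N.-1 * (S *+ 2 / N%:R)).
Proof.
rewrite /c1; set q := (s / N%:R) ^+ _; set P := N%:R ^+ N.
have N0 : N%:R != 0 :> R by rewrite pnatr_eq0 -lt0n ltnW.
have F0 : N`!%:R != 0 :> R by rewrite pnatr_eq0 -lt0n fact_gt0.
by field; apply/andP.
Qed.

Lemma c2_bound (s S : R) :
  frob Y * frob X * ((N%:R - 1) * (s / (N - 2)%:R) ^+ (N - 2)./2 * S) =
  c2 X Y * (N./2%:R * (s / N%:R) ^+ N./2.-1 * (S *+ 2 / N%:R)).
Proof.
have N0 : N%:R != 0 :> R by rewrite pnatr_eq0 -lt0n ltnW.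
have halfE : (N - 2)./2 = N./2.-1 by rewrite subn2; case: N => [|[]].
have NE : N%:R = N./2%:R * 2 :> R.
  by rewrite -natrM muln2 halfK (negbTE hNeven) subn0.
have half0 : N./2%:R != 0 :> R.
  by apply: contra_neq N0; rewrite NE => ->; rewrite mul0r.
rewrite /c2 halfE natrB// !expr_div_n; set k := N./2.-1.
have pow0 : N%:R ^+ k != 0 :> R by rewrite expf_neq0.
have -> : S *+ 2 / N%:R = S / N./2%:R :> R.
  by rewrite NE; field.
(* Naming the inverse keeps it out of the side conditions of [field]. *)
set A := ((N%:R - 2) ^+ k)^-1; set B := N%:R ^+ k in pow0 *.
by field; apply/andP.
Qed.

(** The part of the bound on the objective that is free of [Y] is absorbed by
    [H1], and the part linear in [Y] by [H2]: the two have different degrees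
    of homogeneity in [W]. *)
Lemma normr_ddobjective_le_ddHa (V W : E) :
  `|ddobjective X Y V W| <= ddHa V W.
Proof.
apply: le_trans (normr_ddobjective_le X Y V W) _.
set w := fun i => frob (layer W i); set v := fun i => frob (layer V i).
have w0 i : 0 <= w i by apply: frob_ge0.
have v0 i : 0 <= v i by apply: frob_ge0.
have wE : \sum_i w i ^+ 2 = sqnorm W by rewrite sqnormE.
have vE : \sum_i v i ^+ 2 = sqnorm V by rewrite sqnormE.
have := sum1_sum2_le w v hN; have := sum2_le hNeven w0 v0 hN.
rewrite wE vE => le2 le1.
apply: lerD.
- apply: le_trans (ler_wpM2l (sqr_ge0 _) le1) _; rewrite c1_bound.
  by apply: ler_wpM2l; [exact: c1_ge0|exact: ddnormpow_ge].
- apply: le_trans (ler_wpM2l (mulr_ge0 (frob_ge0 _) (frob_ge0 _)) le2) _.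
  rewrite c2_bound; by apply: ler_wpM2l; [exact: c2_ge0|exact: ddnormpow_ge].
Qed.

(** * The objective and the kernel are polynomial *)

Lemma polyfun_layer i a b : polyfun (fun W : E => layer W i a b).
Proof.
have -> : (fun W : E => layer W i a b) = (fun W => W ord0 (layer_index a b)).
  by apply/funext => W; rewrite layerE.
exact: polyfun_coord.
Qed.

Lemma polyfun_chainmx n (W : E -> layers d n) :
  (forall i a b, polyfun (fun x => W x i a b)) ->
  forall a b, polyfun (fun x => chainmx (W x) a b).
Proof.
elim: n W => [|n IHn] W pW a b /=; first exact: polyfun_cst.
apply: (@polyfun_mxM _ _ _ _ _ (fun x => chainmx (init_layers (W x)))
  (fun x => W x ord_max)) => {a b} [a b|a b]; last exact: pW.
by apply: (IHn (fun x => init_layers (W x))) => i a' b'; apply: pW.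
Qed.

Lemma polyfun_objective : polyfun (objective X Y).
Proof.
have presidual i j : polyfun (fun W => residual X Y W i j).
  have -> : (fun W => residual X Y W i j) =
      (fun W => (chainmx (layer W) *m X) i j + - Y i j).
    by apply/funext => W; rewrite /residual mxE [X in _ + X]mxE.
  apply: polyfunD; last exact: polyfun_cst.
  apply: polyfun_mxM => a b; last exact: polyfun_cst.
  exact/polyfun_chainmx/polyfun_layer.
have -> : objective X Y = fun W =>
    2^-1 * mxdot (residual X Y W) (residual X Y W).
  by apply/funext => W; rewrite objectiveE.
by apply: polyfunM; [apply: polyfun_cst|apply: polyfun_mxdot].
Qed.

Lemma polyfun_normpow n : polyfun (@normpow R N d n).
Proof.
apply: polyfunX; apply: polyfunM; last exact: polyfun_cst.
by apply: polyfun_sum => i; apply: polyfun_mxdot => a b; apply: polyfun_layer.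
Qed.

Lemma polyfun_Ha : polyfun (Ha X Y).
Proof.
have -> : Ha X Y = fun W => c1 X * normpow N W + c2 X Y * normpow N./2 W.
  by apply/funext => y; rewrite HaE.
by apply: polyfunD; apply: polyfunM;
  do ?[exact: polyfun_cst|exact: polyfun_normpow].
Qed.

(** * The objective as a perturbation of the kernel *)

Section Perturbation.
Context (a : R) (a1 : `|a| <= 1).

(** The factor 1 is the constant of the smoothness property: [a = 1] and
    [a = -1] are the two functions required to be convex. *)
Let f (W : E) : R := 1 * Ha X Y W + a * objective X Y W.

Lemma polyfun_perturbation : polyfun f.
Proof.
by apply: polyfunD; apply: polyfunM;
  do ?[exact: polyfun_cst|exact: polyfun_Ha|exact: polyfun_objective].
Qed.

Lemma perturbation_ge_tangent (W V : E) : f W + 'D_V f W <= f (W + V).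
Proof.
have Df W' V' : is_derive W' V' f (1 * dHa V' W' + a * dobjective X Y V' W').
  apply: is_derive_lincomb; last exact: is_derive_objective.
  have -> : Ha X Y = fun W => c1 X * normpow N W + c2 X Y * normpow N./2 W.
    by apply/funext => y; rewrite HaE.
  by apply: is_derive_lincomb; apply: is_derive_normpow.
have DDf W' V' : is_derive W' V'
    (fun y => 1 * dHa V' y + a * dobjective X Y V' y)
    (1 * ddHa V' W' + a * ddobjective X Y V' W').
  apply: is_derive_lincomb; last exact: is_derive_dobjective.
  by apply: is_derive_lincomb; apply: is_derive_dnormpow.
have [_ ->] := Df W V; apply: (ge_tangent Df DDf) => {}W {}V.
have := normr_ddobjective_le_ddHa V W.
have : `|a * ddobjective X Y V W| <= `|ddobjective X Y V W|.
  by rewrite normrM ler_piMl.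
move=> /ler_normlP[]; lra.
Qed.

End Perturbation.
End Domination.

Theorem proposition7 (R : realType) (N : nat) (d : nat -> nat) (nT : nat)
    (hN : (2 <= N)%N) (hNeven : ~~ odd N)
    (hd : forall i : nat, (i <= N)%N -> (0 < d i)%N) (hnT : (0 < nT)%N)
    (X : 'M[R]_(d N, nT)) (Y : 'M[R]_(d 0%N, nT)) :
  kernel_generating_distance [set: wspace d N] (fun W => (Ha X Y W)%:E) /\
  smad 1 (objective X Y) (Ha X Y).
Proof.
have convex (a : R) : `|a| <= 1 ->
    @convex_function R _ setT (fun W => 1 * Ha X Y W + a * objective X Y W).
  move=> a1; apply: convex_of_tangent; last exact: perturbation_ge_tangent.
  exact/polyfun_differentiable/polyfun_perturbation.
split; last split.
- apply: kernel_of_tangent; first exact/polyfun_C1/polyfun_Ha.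
  have a0 : `|0 : R| <= 1 by rewrite normr0.
  have HaE0 : (fun W => 1 * Ha X Y W + 0 * objective X Y W) = Ha X Y.
    by apply/funext => W; rewrite mul1r mul0r addr0.
  move=> W V; have := perturbation_ge_tangent X Y hN hNeven a0 W V.
  by rewrite HaE0 !mul1r !mul0r !addr0.
- exact: ltr01.
- exact/polyfun_C1/polyfun_objective.
- have := convex (-1); rewrite normrN1 => /(_ (lexx _)).
  have -> // : (fun W => 1 * Ha X Y W + -1 * objective X Y W) =
      (fun W => 1 * Ha X Y W - objective X Y W).
  by apply/funext => W; rewrite mulN1r.
- have := convex 1; rewrite normr1 => /(_ (lexx _)).
  have -> // : (fun W => 1 * Ha X Y W + 1 * objective X Y W) =
      (fun W => 1 * Ha X Y W + objective X Y W).
  by apply/funext => W; rewrite [1 * objective X Y W]mul1r.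
Qed.
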